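(* For every $\xi>0$, there exist $m(\xi)\ge1$, $\varepsilon_\ast(\xi)>0$, and $n_0(\xi)\ge1$ such that, whenever $0<\varepsilon\le\varepsilon_\ast(\xi)$ (with $\varepsilon<1$) and $n\ge n_0(\xi)$, one has, for every random tent model with parameter $\varepsilon$ (that is, for every probability measure $\mu_\varepsilon$ supported on $U_\varepsilon$), $$\mathbb P\bigl(n^{-1}\log N_n\le\log 2-\xi\bigr)=0.$$
   Context: For $0<\varepsilon<1$ let $U_\varepsilon:=\{(a,b)\in(0,\infty)^2: |a-2|\le\varepsilon,\ |b-2|\le\varepsilon,\ ab/(a+b)\le1\}$. In the random tent model with parameter $\varepsilon$, $\mu_\varepsilon$ is a probability measure supported on $U_\varepsilon$ and $(\omega_n)_{n\ge1}$ are i.i.d. with law $\mu_\varepsilon$. For $\omega=(a,b)\in U_\varepsilon$ define $T_\omega(x):=\max\{0,\min(ax,b(1-x))\}$, which maps $[0,1]$ into $[0,1]$. Set $F_n:=T_{\omega_n}\circ\cdots\circ T_{\omega_1}$, and let $N_n$ be the smallest number of subintervals partitioning $[0,1]$ on each of which $F_n$ is affine. *)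

(* Defs.v *)
From mathcomp Require Import all_boot all_order all_algebra.
From mathcomp Require Import all_classical all_reals all_analysis.
Set Implicit Arguments.
Unset Strict Implicit.
Unset Printing Implicit Defensive.
Import Order.TTheory GRing.Theory Num.Theory.
Import numFieldNormedType.Exports.
Local Open Scope classical_set_scope.
Local Open Scope ring_scope.

Section TentMaps.
Context {R : realType}.
Implicit Types (eps x : R) (w : R * R) (f : R -> R).

Definition tent_params eps : set (R * R) :=
  [set w | [/\ 0 < w.1 /\ 0 < w.2,
               `|w.1 - 2| <= eps,
               `|w.2 - 2| <= eps &
               w.1 * w.2 / (w.1 + w.2) <= 1]].

Definition tent w x : R :=
  Num.max 0 (Num.min (w.1 * x) (w.2 * (1 - x))).

(* Parameter sequences are indexed from 0: [w k] is the (k+1)-st parameter, so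
   [tent_iter w n] composes exactly the first n maps, [w 0] being applied
   first. *)
Fixpoint tent_iter (w : nat -> R * R) (n : nat) : R -> R :=
  if n is k.+1 then tent (w k) \o tent_iter w k else id.

Definition affine_on f (I : set R) : Prop :=
  exists p q : R, forall x, I x -> f x = p * x + q.

(* Subintervals may be open, closed, half-open or reduced to a point, but are
   nonempty and pairwise disjoint (as required by [partition]). *)
Definition affine_partition f (k : nat) : Prop :=
  exists I : 'I_k -> set R,
    [/\ partition [set: 'I_k] I `[0, 1],
        forall i, is_interval (I i) &
        forall i, affine_on f (I i)].

(* The default value 0 is for functions having no finite affine partition; it
   is never taken by the iterates of tent maps. *)
Definition affine_pieces f : nat :=
  if pselect (exists k, `[< affine_partition f k >]) is left h
  then ex_minn h else 0%N.

End TentMaps.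

Section IID.
Context {d d' : measure_display} {T : measurableType d} {S : measurableType d'}
        {R : realType}.

Definition mutually_independent (P : probability T R) (X : nat -> T -> S) :
    Prop :=
  forall (s : seq nat) (A : nat -> set S),
    uniq s -> (forall k, measurable (A k)) ->
    P (\bigcap_(k in [set` s]) (X k @^-1` A k)) =
      (\prod_(k <- s) P (X k @^-1` A k))%E.

Definition iid (P : probability T R) (X : nat -> T -> S)
    (mu : probability S R) : Prop :=
  [/\ forall k, measurable_fun [set: T] (X k),
      forall k (A : set S), measurable A -> P (X k @^-1` A) = mu A &
      mutually_independent P X].

End IID.

(* [tent_params eps] is closed in the plane when eps < 1, so having full mass on
   it is the same as having topological support inside it. *)
Definition random_tent_model {d : measure_display} {T : measurableType d}
    {R : realType} (eps : R) (P : probability T R) (mu : probability (R * R)%type R)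
    (w : nat -> T -> R * R) : Prop :=
  mu (tent_params eps) = 1%E /\ iid P w mu.

Definition piece_count {T : Type} {R : realType} (w : nat -> T -> R * R)
    (n : nat) (t : T) : nat :=
  affine_pieces (tent_iter (w ^~ t) n).

(* Main.v *)
Require Import Defs.
From mathcomp Require Import all_boot all_order all_algebra.
From mathcomp Require Import all_classical all_reals all_analysis.
From mathcomp Require Import measurable_realfun zify ring lra.
Import Order.TTheory GRing.Theory Num.Theory.
Import numFieldNormedType.Exports.
Local Open Scope classical_set_scope.
Local Open Scope ring_scope.

(** On [U_eps] both branches of a tent map have slope at least [2 - eps] in
    absolute value, so every slope of [F_n] is at least [(2 - eps) ^ n].  As
    [F_n] takes values in [[0, 1]], an interval on which it is affine has length
    at most [(2 - eps) ^ - n], hence [N_n >= (2 - eps) ^ n] almost surely; this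
    exceeds [(2 e^-xi) ^ n] as soon as [eps <= 1 - e^-xi].

    Since a measure is unconstrained on nonmeasurable sets, the event must also
    be shown measurable, including over parameters outside [U_eps].  For a
    continuous piecewise affine map, having at most [K] pieces amounts to the
    absence of [2 K + 1] increasing rational points of [[0, 1]] no three
    consecutive of which carry collinear points of the graph: a countable
    condition. *)

Section AffinePieces.
Set Implicit Arguments.
Unset Strict Implicit.
Unset Printing Implicit Defensive.
Context {R : realType}.
Implicit Types (f g : R -> R) (a b c x y z : R).

(** * Affine functions and broken lines *)

Lemma affine_onS f (A B : set R) : A `<=` B -> affine_on f B -> affine_on f A.
Proof. by move=> AB [p [q h]]; exists p, q => x /AB /h. Qed.

Lemma affine_on_scale f (A : set R) p q :
  affine_on f A -> affine_on (fun x => p * f x + q) A.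
Proof.
move=> [u [v h]]; exists (p * u), (p * v + q) => x Ax.
by rewrite h//; ring.
Qed.

(* The pieces are closed, so consecutive affine formulas agree at the common
   breakpoint: continuity is built in. *)
Inductive broken_line f : nat -> R -> R -> Prop :=
| broken_line0 a : broken_line f 0 a a
| broken_lineS a b c n : a < b -> affine_on f `[a, b] ->
    broken_line f n b c -> broken_line f n.+1 a c.

Lemma broken_line_le f n a b : broken_line f n a b -> a <= b.
Proof. by elim=> // {n b} {}a b c n ab _ _; apply: le_trans; exact: ltW. Qed.

Lemma broken_line_cat f m n a b c :
  broken_line f m a b -> broken_line f n b c -> broken_line f (m + n) a c.
Proof.
elim=> // {m b} {}a b d m ab fab _ ih h; rewrite addSn.
by apply: broken_lineS ab fab (ih h).
Qed.

Lemma broken_line1 f a b : a <= b -> affine_on f `[a, b] ->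
  exists n, broken_line f n a b.
Proof.
rewrite le_eqVlt => /predU1P[<- _|ab fab]; first by exists 0%N; constructor.
by exists 1%N; apply: broken_lineS ab fab _; constructor.
Qed.

Lemma affine_on_eq f g (A : set R) :
  (forall x, A x -> g x = f x) -> affine_on f A -> affine_on g A.
Proof. by move=> fg [p [q h]]; exists p, q => x Ax; rewrite fg// h. Qed.

Lemma broken_line_ext f g n a b :
  f =1 g -> broken_line f n a b -> broken_line g n a b.
Proof.
move=> fg; elim=> {n a b} [a|a b c n ab fab _]; first by constructor.
by apply: broken_lineS ab _; apply: affine_on_eq fab => x _; rewrite fg.
Qed.

Lemma broken_line_scale f p q n a b :
  broken_line f n a b -> broken_line (fun x => p * f x + q) n a b.
Proof.
elim=> {n a b} [a|a b c n ab fab _ ih]; first by constructor.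
by apply: broken_lineS ab _ ih; exact: affine_on_scale.
Qed.

(** Reduces an operation on a broken line to its effect on a single affine piece: the broken lines
    obtained over the pieces are concatenated. *)
Lemma broken_line_bind (g : (R -> R) -> R -> R) f n a b :
  (forall a b, a <= b -> affine_on f `[a, b] ->
     exists m, broken_line (g f) m a b) ->
  broken_line f n a b -> exists m, broken_line (g f) m a b.
Proof.
move=> h; elim=> {n a b} [a|a b c n ab fab _ [m hm]].
  by exists 0%N; constructor.
have [k hk] := h _ _ (ltW ab) fab.
by exists (k + m)%N; exact: broken_line_cat hm.
Qed.

(** Two affine functions either keep their order on [[a, b]] or cross once; cutting at the crossing
    leaves the minimum affine on each side. *)
Lemma broken_line_min f g a b : a <= b ->
  affine_on f `[a, b] -> affine_on g `[a, b] ->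
  exists n, broken_line (fun x => Num.min (f x) (g x)) n a b.
Proof.
move=> ab [p [q hf]] [r [s hg]].
have minf x y : a <= x -> x <= y -> y <= b ->
    p * x + q <= r * x + s -> p * y + q <= r * y + s ->
    exists n, broken_line (fun x => Num.min (f x) (g x)) n x y.
  move=> ax xy yb hx hy; apply: broken_line1 => //; exists p, q => z /=.
  rewrite in_itv/= => /andP[xz zy].
  have zab : `[a, b]%classic z by rewrite /= in_itv/= (le_trans ax xz) (le_trans zy yb).
  by rewrite hf// hg//; apply/min_idPl; have [pr|pr] := leP p r; nra.
have ming x y : a <= x -> x <= y -> y <= b ->
    r * x + s <= p * x + q -> r * y + s <= p * y + q ->
    exists n, broken_line (fun x => Num.min (f x) (g x)) n x y.
  move=> ax xy yb hx hy; apply: broken_line1 => //; exists r, s => z /=.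
  rewrite in_itv/= => /andP[xz zy].
  have zab : `[a, b]%classic z by rewrite /= in_itv/= (le_trans ax xz) (le_trans zy yb).
  by rewrite hf// hg//; apply/min_idPr; have [pr|pr] := leP p r; nra.
(* The quotient is the abscissa where the two lines meet. *)
have cross : p != r -> p * ((s - q) / (p - r)) + q = r * ((s - q) / (p - r)) + s.
  by move=> pr; field; rewrite subr_eq0.
pose x := (s - q) / (p - r).
have [fga|gfa] := leP (p * a + q) (r * a + s);
  have [fgb|gfb] := leP (p * b + q) (r * b + s).
- exact: minf.
- have pr : p != r by apply/eqP => pr; rewrite pr in fga gfb; lra.
  have := cross pr; rewrite -/x => hx.
  have ax : a <= x by nra.
  have xb : x <= b by nra.
  have [n hn] := minf a x (lexx _) ax xb fga ltac:(lra).
  have [m hm] := ming x b ax xb (lexx _) ltac:(lra) (ltW gfb).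
  by exists (n + m)%N; exact: broken_line_cat hm.
- have pr : p != r by apply/eqP => pr; rewrite pr in gfa fgb; lra.
  have := cross pr; rewrite -/x => hx.
  have ax : a <= x by nra.
  have xb : x <= b by nra.
  have [n hn] := ming a x (lexx _) ax xb (ltW gfa) ltac:(lra).
  have [m hm] := minf x b ax xb (lexx _) ltac:(lra) fgb.
  by exists (n + m)%N; exact: broken_line_cat hm.
- exact: ming _ _ (ltW gfa) (ltW gfb).
Qed.

Lemma broken_line_max0 f n a b : broken_line f n a b ->
  exists m, broken_line (fun x => Num.max 0 (f x)) m a b.
Proof.
apply: (@broken_line_bind (fun f x => Num.max 0 (f x))) => {n a b} a b ab fab.
have cst : affine_on (fun=> 0) `[a, b] by exists 0, 0 => x _; ring.
(* The maximum of 0 and [f] is the opposite of the minimum of 0 and [- f]. *)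
have [m hm] := broken_line_min ab cst (affine_on_scale (-1) 0 fab).
exists m; apply: broken_line_ext (broken_line_scale (-1) 0 hm) => x.
by rewrite addr0 mulN1r oppr_min oppr0 addr0 mulN1r opprK.
Qed.

Lemma broken_line_tent f w n a b : broken_line f n a b ->
  exists m, broken_line (tent w \o f) m a b.
Proof.
apply: (@broken_line_bind (fun f => tent w \o f)) => {n a b} a b ab fab.
have [m hm] := broken_line_min ab (affine_on_scale w.1 0 fab)
  (affine_on_scale (- w.2) w.2 fab).
have [k hk] := broken_line_max0 hm.
exists k; apply: broken_line_ext hk => x /=; rewrite /tent.
by congr (Num.max 0 (Num.min _ _)); ring.
Qed.

Lemma broken_line_tent_iter (w : nat -> R * R) n a b : a <= b ->
  exists m, broken_line (tent_iter w n) m a b.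
Proof.
move=> ab; elim: n => [|n [m ih]] /=; last exact: broken_line_tent ih.
by apply: broken_line1 => //; exists 1, 0 => x _ /=; ring.
Qed.

(** * From broken lines to partitions into intervals *)

(** Every piece but the last is made half-open, so that breakpoints are not shared. With [n = 0] the
    single point [a = c] would stay uncovered. Indexing by bounded naturals makes the shift in the
    induction a plain successor. *)
Lemma broken_line_partition f n a c : (0 < n)%N -> broken_line f n a c ->
  exists I : nat -> set R,
  [/\ forall x, a <= x <= c <-> exists2 i, (i < n)%N & I i x,
      forall i j x, I i x -> I j x -> (i < n)%N -> (j < n)%N -> i = j,
      forall i, (i < n)%N -> I i !=set0,
      forall i, (i < n)%N -> is_interval (I i) &
      forall i, (i < n)%N -> affine_on f (I i)].
Proof.
move=> + fac; elim: fac => // {n a c} a b c [|n] ab fab fbc ih _.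
  inversion fbc; subst c; exists (fun=> `[a, b]%classic); split => //.
  - move=> x; split=> [h|[i _]]; first by exists 0%N.
    by rewrite /= in_itv.
  - by move=> [|i] [|j].
  - by move=> i _; exists a; rewrite /= in_itv/= lexx ltW.
  - by move=> i _; exact: interval_is_interval.
have [I [Ieq Idis I0 Iitv Iaff]] := ih isT.
have bc := broken_line_le fbc.
have Ib i x : (i < n.+1)%N -> I i x -> b <= x.
  move=> i1 Iix; have /Ieq/andP[]// : exists2 i, (i < n.+1)%N & I i x by exists i.
exists (fun i => if i is j.+1 then I j else `[a, b[%classic); split.
- move=> x; split.
    move=> /andP[ax xc]; have [xb|bx] := ltP x b.
      by exists 0%N => //; rewrite /= in_itv/= ax.
    by have /Ieq[i ? ?] : b <= x <= c by [rewrite bx|]; exists i.+1.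
  move=> [[_|i i1]].
    by rewrite /= in_itv/= => /andP[-> /ltW/le_trans ->].
  move=> Iix; have /Ieq/andP[bx ->] : exists2 i, (i < n.+1)%N & I i x by exists i.
  by rewrite (le_trans (ltW ab) bx).
- move=> [|i] [|j] x //=.
  + by rewrite in_itv/= => /andP[_ xb] /Ib h _ /h; rewrite leNgt xb.
  + by move=> /Ib h; rewrite in_itv/= => /andP[_ xb] /h; rewrite leNgt xb.
  + by move=> Ii Ij i1 j1; rewrite (Idis _ _ _ Ii Ij i1 j1).
- by move=> [_|//]; exists a; rewrite /= in_itv/= lexx.
- by move=> [_|//]; exact: interval_is_interval.
- move=> [_|//]; apply: affine_onS fab => x /=.
  by rewrite !in_itv/= => /andP[-> /ltW].
Qed.

Lemma broken_line_affine_partition f n :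
  broken_line f n 0 1 -> affine_partition f n.
Proof.
move=> fn; have n0 : (0 < n)%N.
  by case: n fn => // fn; inversion fn; exfalso; lra.
have [I [Ieq Idis I0 Iitv Iaff]] := broken_line_partition n0 fn.
exists (fun i : 'I_n => I i); split=> [|i|i]; [split| |].
- apply/seteqP; split=> x /=; rewrite in_itv/=.
    by move=> [i _ Iix]; apply/Ieq; exists i.
  by move=> /Ieq[i ni Iix]; exists (Ordinal ni).
- by move=> i j _ _ [x [Ii Ij]]; apply/val_inj/(Idis _ _ _ Ii Ij).
- by move=> i _; exact: I0.
- exact: Iitv.
- exact: Iaff.
Qed.

(** * Counting pieces by rational zigzags *)

(** The slopes of two adjacent chords are compared without division; for fixed abscissas this is an
    equation in the values of [f], which suits measurability. *)
Definition collinear f x y z := (f y - f x) * (z - y) = (f z - f y) * (y - x).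

Definition zigzag f (s : seq R) :=
  forall i, (i.+2 < size s)%N -> ~ collinear f s`_i s`_i.+1 s`_i.+2.

Lemma affine_on_collinear f (A : set R) x y z :
  affine_on f A -> A x -> A y -> A z -> collinear f x y z.
Proof. by move=> [p [q h]] Ax Ay Az; rewrite /collinear !h//; ring. Qed.

(** Two lines that meet at [b] and at a second point [z] coincide. *)
Lemma affine_on_glue f a b c p q r s z : a < b < c ->
  (forall x, a <= x <= b -> f x = p * x + q) ->
  (forall x, b <= x <= c -> f x = r * x + s) ->
  z != b -> p * z + q = r * z + s -> affine_on f `[a, c].
Proof.
move=> /andP[ab bc] hp hr zb e.
have eb : p * b + q = r * b + s.
  rewrite -(hp b); last by lra.
  by apply: hr; lra.
have /eqP : (p - r) * (z - b) = 0 by lra.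
rewrite mulf_eq0 !subr_eq0 (negbTE zb) orbF => /eqP pr; subst r.
have qs : q = s by lra.
exists p, q => x; rewrite /= in_itv/= => /andP[ax xc].
have [xb|bx] := leP x b; first by rewrite hp// ax.
by rewrite qs hr// xc ltW.
Qed.

(** The left line is determined by [x] and [y]; collinearity makes it pass through the graph point
    at [z], which is also on the right line. *)
Lemma affine_on_gluel f a b c x y z : a < b < c ->
  affine_on f `[a, b] -> affine_on f `[b, c] ->
  a <= x -> x < y -> y <= b -> b < z -> z <= c ->
  collinear f x y z -> affine_on f `[a, c].
Proof.
move=> abc [p [q h]] [r [s k]] ax xy yb bz zc + .
have hp t : a <= t <= b -> f t = p * t + q by move=> ?; rewrite h//= in_itv.
have hr t : b <= t <= c -> f t = r * t + s by move=> ?; rewrite k//= in_itv.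
rewrite /collinear (hp x) ?(hp y) ?(hr z); [|lra..] => e.
apply: (affine_on_glue (z := z) abc hp hr); first by rewrite gt_eqF.
apply: (@mulfI _ (y - x)); first by rewrite gt_eqF// subr_gt0.
lra.
Qed.

(** Mirror image: [y] and [z] determine the right line, and [x] is the second meeting point. *)
Lemma affine_on_gluer f a b c x y z : a < b < c ->
  affine_on f `[a, b] -> affine_on f `[b, c] ->
  a <= x -> x < b -> b <= y -> y < z -> z <= c ->
  collinear f x y z -> affine_on f `[a, c].
Proof.
move=> abc [p [q h]] [r [s k]] ax xb yb yz zc + .
have hp t : a <= t <= b -> f t = p * t + q by move=> ?; rewrite h//= in_itv.
have hr t : b <= t <= c -> f t = r * t + s by move=> ?; rewrite k//= in_itv.
rewrite /collinear (hp x) ?(hr y) ?(hr z); [|lra..] => e.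
apply: (affine_on_glue (z := x) abc hp hr); first by rewrite lt_eqF.
apply: (@mulfI _ (z - y)); first by rewrite gt_eqF// subr_gt0.
lra.
Qed.

Lemma rat_lt_rat a b : a < b ->
  exists q r : rat, [/\ a < ratr q, ratr q < ratr r :> R & ratr r < b].
Proof.
move=> ab; have [q] := rat_in_itvoo ab; rewrite in_itv/= => /andP[aq qb].
have [r] := rat_in_itvoo qb; rewrite in_itv/= => /andP[qr rb].
by exists q, r.
Qed.

(* Two rational points inside each piece: were three consecutive ones
   collinear, two adjacent pieces could be merged. *)
Lemma broken_line_zigzag f n a c :
  (forall m, broken_line f m a c -> (n < m)%N) -> broken_line f n.+1 a c ->
  exists (q r : rat) (s : seq rat) b,
    let s' := map ratr [:: q, r & s] in
    [/\ size s = n.*2, path <%R a s', all (< c) s', zigzag f s' &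
        [/\ a < b, ratr r < b, affine_on f `[a, b] & broken_line f n b c]].
Proof.
elim: n a c => [|n ih] a c + fac.
  inversion fac as [|? b ? ? ab fab fbc]; subst.
  inversion fbc; subst => _.
  have [q [r [aq qr rb]]] := rat_lt_rat ab.
  exists q, r, [::], c; split => //=.
  - by rewrite aq qr.
  - by rewrite rb (lt_trans qr rb).
inversion fac as [|? b ? ? ab fab fbc]; subst => minac.
have minbc m : broken_line f m b c -> (n < m)%N.
  by move=> /(broken_lineS ab fab)/minac; rewrite ltnS.
have [u [v [s [b' [szs psc allc zz [bb' vb' fbb' fb'c]]]]]] := ih _ _ minbc fbc.
have naff : ~ affine_on f `[a, b'].
  move=> fab'; have := minac _ (broken_lineS (lt_trans ab bb') fab' fb'c).
  by rewrite ltnn.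
have [q [r [aq qr rb]]] := rat_lt_rat ab.
have bc : b < c.
  by apply: lt_le_trans bb' (broken_line_le fb'c).
move: (psc); rewrite /= => /and3P[bu uv _].
exists q, r, [:: u, v & s], b; split => //.
- by rewrite /= szs.
- move: psc; rewrite /= => /andP[_ ->].
  by rewrite aq qr (lt_trans rb bu).
- by move: allc => /= ->; rewrite !(lt_trans _ bc)// (lt_trans qr).
- have abb' : a < b < b' by rewrite ab bb'.
  have ub' := lt_trans uv vb'.
  have rb' := lt_trans rb bu.
  (* Only the triples [q, r, u] and [r, u, v] straddle [b]; the later ones belong to the zigzag
     given by induction. *)
  move=> [|[|i]] //=.
  + by move=> _ /(affine_on_gluel abb' fab fbb') h; apply: naff; apply: h; lra.
  + by move=> _ /(affine_on_gluer abb' fab fbb') h; apply: naff; apply: h; lra.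
  + exact: zz.
Qed.

(** Two of the [k + 1] points [x 0, ..., x k] share one of the [k] intervals; by monotonicity and
    convexity that interval also contains the successor of the first one. *)
Lemma affine_partition_pigeonhole f k (x : nat -> R) : affine_partition f k ->
  (forall i, (i < k)%N -> x i <= x i.+1) -> 0 <= x 0%N -> x k <= 1 ->
  exists (i : nat) (J : set R),
    [/\ (i < k)%N, is_interval J, affine_on f J, J (x i) & J (x i.+1)].
Proof.
move=> [I [[Icov _ _] Iitv Iaff]] xS x0 xk.
have xle i j : (i <= j <= k)%N -> x i <= x j.
  move=> /andP[]; elim: j => [|j ih]; first by rewrite leqn0 => /eqP ->.
  rewrite leq_eqVlt => /predU1P[->//|ij jk].
  by apply: le_trans (xS _ jk); apply: ih => //; exact: ltnW.
have /choice[h hI] : forall j : 'I_k.+1, exists i, I i (x j).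
  move=> j; have : `[0, 1]%classic (x j).
    have jk : (j <= k)%N by rewrite -ltnS.
    rewrite /= in_itv/= (le_trans x0 (xle 0%N j _))//.
    by rewrite (le_trans (xle j k _))// jk leqnn.
  by rewrite -Icov => -[i _ ?]; exists i.
have : ~~ injectiveb h.
  apply/injectiveP => /leq_card; rewrite !card_ord ltnn//.
move=> /injectivePn[i [j ij hij]].
wlog {ij} ij : i j hij / (i < j)%N.
  move=> W; have [ltij|ltji|/val_inj eij] := ltngtP i j.
  - exact: (W i j).
  - exact: (W j i).
  - by rewrite eij eqxx in ij.
have jk : (j <= k)%N by rewrite -ltnS.
have Ixi := hI i; have Ixj := hI j; rewrite -hij in Ixj.
exists i, (I (h i)); split => //.
- exact: leq_trans jk.
- apply: (Iitv _ _ _ Ixi Ixj); apply/andP; split; apply: xle.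
    by rewrite leqnSn (leq_trans ij).
  by rewrite ij.
Qed.

(** With more than [2 k] points, those of even index up to [2 k] number [k + 1]. Two neighbours
    among them share a piece, which then contains the odd-indexed point between them: a collinear
    triple. *)
Lemma zigzag_size f k (s : seq R) : affine_partition f k ->
  sorted <%R s -> all (fun x => 0 <= x <= 1) s -> zigzag f s ->
  (size s <= k.*2)%N.
Proof.
move=> fk ss s01 zz; rewrite leqNgt; apply/negP => ks.
have slt i j : (i < j)%N -> (j < size s)%N -> s`_i < s`_j.
  move=> ij js; apply: (sorted_ltn_nth lt_trans) => //.
  by rewrite inE (ltn_trans ij).
have sin i : (i < size s)%N -> 0 <= s`_i <= 1.
  by move=> si; move/(all_nthP 0): s01; apply.
have [|||i [J [ik Jitv Jaff Ji Ji1]]] :=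
    affine_partition_pigeonhole (x := fun i => s`_(i.*2)) fk.
- by move=> i ik; apply/ltW/slt; lia.
- by have /andP[] := sin 0%N ltac:(lia).
- by have /andP[] := sin k.*2 ks.
rewrite doubleS in Ji1.
apply: (zz i.*2); first by lia.
apply: (affine_on_collinear Jaff) => //.
by apply: (Jitv _ _ Ji Ji1); rewrite !ltW// slt//; lia.
Qed.

Lemma affine_piecesP f k : affine_partition f k ->
  affine_partition f (affine_pieces f) /\ (affine_pieces f <= k)%N.
Proof.
move=> fk; rewrite /affine_pieces; case: pselect => [h|[]]; last first.
  by exists k; exact/asboolP.
by case: ex_minnP => m /asboolP fm minm; split=> //; apply/minm/asboolP.
Qed.

(** Forward, a minimal partition bounds every zigzag. Backward, a shortest broken line with [n + 1]
    pieces yields a zigzag of [2 n + 2] points, hence [n + 1 <= K], and its pieces form a partition.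
    Rational points keep the quantifier countable. *)
Lemma affine_pieces_leP f m K : broken_line f m 0 1 ->
  (affine_pieces f <= K)%N <->
  forall s : seq rat, let s' := map ratr s : seq R in
    sorted <%R s' -> all (fun x => 0 <= x <= 1) s' -> zigzag f s' ->
    (size s <= K.*2)%N.
Proof.
move=> fm.
have [fp _] := affine_piecesP (broken_line_affine_partition fm).
split=> [fK s s' ss s01 zz|H].
  rewrite (leq_trans _ (_ : (affine_pieces f).*2 <= _)%N) ?leq_double//.
  by have := zigzag_size fp ss s01 zz; rewrite size_map.
have exn : exists n, `[< broken_line f n 0 1 >] by exists m; exact/asboolP.
have [n /asboolP fn minn] := ex_minnP exn.
have n0 : (0 < n)%N.
  by case: n fn {minn} => // fn; inversion fn; exfalso; lra.
case: n => // n in fn minn n0 *.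
have minn' k : broken_line f k 0 1 -> (n < k)%N.
  by move=> fk; apply: minn; exact/asboolP.
have [q [r [s [b [szs pth all1 zz _]]]]] := broken_line_zigzag minn' fn.
have [_] := affine_piecesP (broken_line_affine_partition fn).
move=> /leq_trans; apply.
rewrite -leq_double; apply: leq_trans (H [:: q, r & s] _ _ zz).
- by rewrite /= szs.
- exact: path_sorted pth.
- have /allP tgt0 := order_path_min lt_trans pth.
  apply/allP => x xt; apply/andP; split; apply/ltW; first exact: tgt0.
  exact: (allP all1).
Qed.

(** * Expansion of tent iterates and the lower bound on partitions *)

Lemma tent_params_itv01 eps w x : tent_params eps w -> 0 <= x <= 1 ->
  0 <= tent w x <= 1.
Proof.
case: w => a b [/= [a0 b0] _ _]; rewrite ler_pdivrMr ?addr_gt0// mul1r => ab.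
move=> /andP[x0 x1]; rewrite /tent/= le_max lexx/= ge_max ler01/=.
rewrite ge_min; apply/orP.
(* If [a x > 1], then [b (1 - x) < b - b / a], which is at most 1 because [a b <= a + b]. *)
have [h|h] := leP (a * x) 1; [by left | right; nra].
Qed.

Lemma tent_iter_itv01 eps (w : nat -> R * R) n x :
  (forall k, tent_params eps (w k)) -> 0 <= x <= 1 ->
  0 <= tent_iter w n x <= 1.
Proof. by move=> wP x01; elim: n => //= n; exact: tent_params_itv01 (wP n). Qed.

(** Cut at the midpoint: the sign there and the sign of the slope select a half on which the affine
    function keeps its sign. This serves to confine an iterate to one branch of the next tent. *)
Lemma affine_constant_sign p q x y : x < y ->
  exists x' y', [/\ x <= x', x' < y', y' <= y &
    (forall z, x' <= z <= y' -> p * z + q <= 0) \/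
    (forall z, x' <= z <= y' -> 0 <= p * z + q)].
Proof.
move=> xy; pose m := (x + y) / 2.
have xm : x < m by rewrite /m; lra.
have my : m < y by rewrite /m; lra.
have [p0|p0] := leP 0 p; have [u0|u0] := leP (p * m + q) 0.
- by exists x, m; split; [lra..|left=> z ?; nra].
- by exists m, y; split; [lra..|right=> z ?; nra].
- by exists m, y; split; [lra..|left=> z ?; nra].
- by exists x, m; split; [lra..|right=> z ?; nra].
Qed.

(** Rather than describing all pieces, the induction shrinks the interval at each step so that a
    single branch acts, multiplying the slope by [a] or [- b]. A subinterval is enough, since it
    already determines the slope of any affine formula valid on the larger interval. *)
Lemma tent_iter_expanding eps (w : nat -> R * R) n x y : eps < 1 ->
  (forall k, tent_params eps (w k)) -> 0 <= x -> x < y -> y <= 1 ->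
  exists x' y' p q, [/\ x <= x', x' < y', y' <= y, (2 - eps) ^+ n <= `|p| &
    forall z, x' <= z <= y' -> tent_iter w n z = p * z + q].
Proof.
move=> eps1 wP x0 xy y1; elim: n => [|n [x1 [y1' [p [q [xx1 xy1 yy1 hp hF]]]]]].
  exists x, y, 1, 0; split=> //; first by rewrite expr0 normr1.
  by move=> z _ /=; rewrite mul1r addr0.
have [[a0 b0] aeps beps _] := wP n.
have ha : 2 - eps <= (w n).1 by move: aeps; rewrite ler_norml; lra.
have hb : 2 - eps <= (w n).2 by move: beps; rewrite ler_norml; lra.
have F01 z : x1 <= z <= y1' -> 0 <= p * z + q <= 1.
  move=> hz; rewrite -hF//; apply: tent_iter_itv01 wP _.
  by case/andP: hz => *; apply/andP; split; lra.
set a := (w n).1 in a0 ha *; set b := (w n).2 in b0 hb *.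
have grow r : 2 - eps <= r -> (2 - eps) ^+ n.+1 <= `|r * p|.
  move=> hr; rewrite exprS normrM ler_pM ?exprn_ge0//; [lra|lra|].
  by rewrite (le_trans hr)// ler_norm.
(* With [u = p z + q], the difference of the branches [a u - b (1 - u)] equals [(a + b) u - b]; its
   sign tells which branch is the minimum. *)
have [x2 [y2 [xx2 xy2 yy2 hs]]] :=
  affine_constant_sign ((a + b) * p) ((a + b) * q - b) xy1.
case: hs => hs.
- exists x2, y2, (a * p), (a * q); split; [lra|lra|lra|exact: grow|].
  move=> z hz; have hz1 : x1 <= z <= y1' by lra.
  rewrite /= hF// /tent -/a -/b; have := F01 z hz1; have := hs z hz => h1 h2.
  rewrite min_l; last by lra.
  by rewrite max_r; [ring|nra].
- exists x2, y2, (- b * p), (b - b * q); split; [lra|lra|lra| |].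
    by rewrite mulNr normrN; exact: grow.
  move=> z hz; have hz1 : x1 <= z <= y1' by lra.
  rewrite /= hF// /tent -/a -/b; have := F01 z hz1; have := hs z hz => h1 h2.
  rewrite min_r; last by lra.
  by rewrite max_r; [ring|nra].
Qed.

(** The slope on [J] is the one found on the subinterval, and the increment of the iterate between
    [x] and [y] is at most 1 since its values stay in [[0, 1]]. *)
Lemma tent_iter_affine_length eps (w : nat -> R * R) n x y (J : set R) :
  eps < 1 -> (forall k, tent_params eps (w k)) ->
  0 <= x -> x < y -> y <= 1 -> is_interval J -> J x -> J y ->
  affine_on (tent_iter w n) J -> (2 - eps) ^+ n * (y - x) <= 1.
Proof.
move=> eps1 wP x0 xy y1 Jitv Jx Jy [r [s hJ]].
have [x' [y' [p [q [xx' xy' yy' hp hF]]]]] :=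
  tent_iter_expanding n eps1 wP x0 xy y1.
have rp : r = p.
  have := hF x' ltac:(lra); have := hF y' ltac:(lra).
  rewrite !hJ; [|by apply: (Jitv _ _ Jx Jy); lra..].
  move=> e1 e2; apply: (@mulIf _ (y' - x')); first by rewrite gt_eqF// subr_gt0.
  lra.
rewrite -{}rp in hp.
apply: le_trans (_ : `|r| * (y - x) <= _); first by rewrite ler_pM2r ?subr_gt0.
rewrite -(gtr0_norm (_ : 0 < y - x)) ?subr_gt0// -normrM.
have -> : r * (y - x) = tent_iter w n y - tent_iter w n x by rewrite !hJ//; ring.
have x01 : 0 <= x <= 1 by lra.
have y01 : 0 <= y <= 1 by lra.
have := tent_iter_itv01 n wP x01; have := tent_iter_itv01 n wP y01.
by rewrite ler_norml; lra.
Qed.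

Lemma tent_iter_affine_partition_ge eps (w : nat -> R * R) n k :
  eps < 1 -> (forall k, tent_params eps (w k)) ->
  affine_partition (tent_iter w n) k -> (2 - eps) ^+ n <= k%:R.
Proof.
move=> eps1 wP hk.
(* Pigeonhole on the regular grid of mesh [1 / k]: some piece contains two neighbouring grid
   points. *)
have [|||i [J [ik Jitv Jaff Ji Ji1]]] :=
    affine_partition_pigeonhole (x := fun i => i%:R / k%:R) hk.
- by move=> i _; rewrite ler_wpM2r ?invr_ge0// ler_nat.
- by rewrite mul0r.
(* For [k = 0] the quotient is 0 by convention; that case is excluded afterwards by [i < k]. *)
- by case: (k) => [|k']; rewrite ?mul0r// divff.
have k0 : 0 < k%:R :> R by rewrite ltr0n (leq_trans _ ik).
have h0 : 0 <= i%:R / k%:R :> R by rewrite divr_ge0.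
have hlt : i%:R / k%:R < i.+1%:R / k%:R :> R.
  by rewrite ltr_pM2r ?invr_gt0// ltr_nat.
have h1 : i.+1%:R / k%:R <= 1 :> R by rewrite ler_pdivrMr// mul1r ler_nat.
have := tent_iter_affine_length eps1 wP h0 hlt h1 Jitv Ji Ji1 Jaff.
by rewrite -mulrBl -natrB// subSnn mul1r ler_pdivrMr// mul1r.
Qed.

End AffinePieces.

(** * Measurability of the parameter set and of the piece count *)

Section Measurability.
Set Implicit Arguments.
Unset Strict Implicit.
Unset Printing Implicit Defensive.
Context {R : realType} {d : measure_display} {T : measurableType d}.
Implicit Types (w : nat -> T -> R * R).

Lemma measurable_tent_params (eps : R) :
  measurable (tent_params eps : set (R * R)).
Proof.
have mb (f : R * R -> bool) : measurable_fun setT f -> measurable [set w | f w].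
  by move=> mf; rewrite -[X in measurable X]setTI; exact: mf.
rewrite (_ : tent_params eps = [set w | [&& 0 < w.1, 0 < w.2, `|w.1 - 2| <= eps,
    `|w.2 - 2| <= eps & w.1 * w.2 <= w.1 + w.2]]); last first.
  apply/seteqP; split=> -[a b] /=.
    by move=> [/= [a0 b0] -> ->]; rewrite ler_pdivrMr ?addr_gt0// mul1r a0 b0.
  move=> /and5P[a0 b0 ? ? ?]; split => //=.
  by rewrite ler_pdivrMr ?addr_gt0// mul1r.
apply: mb; do !apply: measurable_and => /=.
- exact: measurable_fun_ltr.
- exact: measurable_fun_ltr.
- apply: measurable_fun_ler => //; apply: measurableT_comp => //.
  exact: measurable_funB.
- apply: measurable_fun_ler => //; apply: measurableT_comp => //.
  exact: measurable_funB.
- apply: measurable_fun_ler; first exact: measurable_funM.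
  exact: measurable_funD.
Qed.

Lemma measurable_tent_iter w n x :
  (forall k, measurable_fun setT (w k)) ->
  measurable_fun setT (fun t => tent_iter (w ^~ t) n x).
Proof.
move=> mw; elim: n => [|n ih] /=; first exact: measurable_cst.
have [m1 m2] := (measurable_fun_pairP (w n)).1 (mw n).
apply: measurable_maxr => //; apply: measurable_minr.
  exact: measurable_funM.
by apply: measurable_funM => //; exact: measurable_funB.
Qed.

Lemma measurable_piece_count_le w n K :
  (forall k, measurable_fun setT (w k)) ->
  measurable [set t | (piece_count w n t <= K)%N].
Proof.
move=> mw.
(* The event that the triple at index [i] is collinear, empty out of range so that the union may run
   over all [i]. The list conditions in [adm] do not depend on [t]. *)
pose col (s : seq rat) (i : nat) : set T :=
  if (i.+2 < size s)%N then
    let s' := map ratr s : seq R in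
    [set t | collinear (tent_iter (w ^~ t) n) s'`_i s'`_i.+1 s'`_i.+2]
  else set0.
pose adm (s : seq rat) := let s' := map ratr s : seq R in
  [&& sorted <%R s', all (fun x => 0 <= x <= 1) s' & (K.*2 < size s)%N].
rewrite (_ : [set t | _] =
    \bigcap_(s in [set s | adm s]) \bigcup_i col s i); last first.
  apply/seteqP; split => t /=.
    move=> tK s /= /and3P[ss s01 sK].
    apply: contrapT => ncol; move: sK; apply/negP; rewrite -leqNgt.
    have [m hm] := broken_line_tent_iter (w ^~ t) n (@ler01 R).
    apply: (affine_pieces_leP K hm).1 => // i; rewrite size_map => i2 hc.
    by apply: ncol; exists i => //; rewrite /col i2.
  move=> tK.
  have [m hm] := broken_line_tent_iter (w ^~ t) n (@ler01 R).
  apply/(affine_pieces_leP K hm) => s s' ss s01 zz.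
  rewrite leqNgt; apply/negP => sK.
  have [|i _] := tK s; first by rewrite /= /adm ss s01 sK.
  rewrite /col; case: ifPn => // i2.
  by apply: zz; rewrite size_map.
(* Lists of rationals are countable, so by complementation the intersection becomes a countable
   union. *)
rewrite bigcap_mkcond -[X in measurable X]setCK setC_bigcap; apply: measurableC.
apply: countable_bigcupT_measurable => // s; apply: measurableC.
case: ifPn => // _; apply: bigcupT_measurable => i; rewrite /col.
case: ifPn => // _ /=; rewrite /collinear.
set x := _`_i; set y := _`_i.+1; set z := _`_i.+2.
have mF u := measurable_tent_iter n u mw.
have -> : [set t | (tent_iter (w ^~ t) n y - tent_iter (w ^~ t) n x) * (z - y) =
    (tent_iter (w ^~ t) n z - tent_iter (w ^~ t) n y) * (y - x)] =
  [set: T] `&` [set t | (tent_iter (w ^~ t) n y - tent_iter (w ^~ t) n x) * (z - y) ==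
    (tent_iter (w ^~ t) n z - tent_iter (w ^~ t) n y) * (y - x)].
  by rewrite setTI; apply/seteqP; split=> t /= /eqP.
have mB u v c : measurable_fun setT
    (fun t => (tent_iter (w ^~ t) n u - tent_iter (w ^~ t) n v) * c).
  by apply: measurable_funM => //; apply: measurable_funB.
exact: (measurable_fun_eqr (mB y x (z - y)) (mB z y (y - x))).
Qed.

(** Each level set is a sublevel set minus the smaller ones, and [B] is a countable union of
    levels. *)
Lemma measurable_piece_count w n (B : set nat) :
  (forall k, measurable_fun setT (w k)) ->
  measurable [set t | B (piece_count w n t)].
Proof.
move=> mw.
rewrite (_ : [set t | _] = \bigcup_(k in B)
  ([set t | (piece_count w n t <= k)%N] `\`
   \bigcup_(j in `I_k) [set t | (piece_count w n t <= j)%N])); last first.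
  apply/seteqP; split => t /=.
    move=> Bt; exists (piece_count w n t) => //; split=> //=.
    by move=> [j /= jk]; rewrite leqNgt jk.
  move=> [k Bk [/= tk nt]].
  suff -> : piece_count w n t = k by [].
  apply/eqP; rewrite eqn_leq tk/= leqNgt; apply/negP => kt.
  by apply: nt; exists (piece_count w n t) => /=.
apply: bigcup_measurable => k _; apply: measurableD.
  exact: measurable_piece_count_le.
by apply: bigcup_measurable => j _; exact: measurable_piece_count_le.
Qed.

End Measurability.

(** * The probability estimate *)

Theorem theorem2p8 (R : realType) (xi : R) (hxi : 0 < xi) :
  exists (m : nat) (eps_star : R) (n0 : nat),
    [/\ (1 <= m)%N, 0 < eps_star, (1 <= n0)%N &
      forall (eps : R) (n : nat),
        0 < eps -> eps < 1 -> eps <= eps_star -> (n0 <= n)%N ->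
        forall (d : measure_display) (T : measurableType d)
          (P : probability T R) (mu : probability (R * R)%type R)
          (w : nat -> T -> R * R),
          random_tent_model eps P mu w ->
          P [set t | n%:R^-1 * ln ((piece_count w n t)%:R : R) <= ln 2 - xi]
            = 0%E].
Proof.
have e1 : expR (- xi) < 1 by rewrite expR_lt1 oppr_lt0.
(* This threshold gives [2 - eps >= 1 + expR (- xi) > 2 * expR (- xi)], and the estimate holds from
   [n = 1] on. *)
exists 1%N, (1 - expR (- xi)), 1%N; split => //; first by rewrite subr_gt0.
move=> eps n eps0 eps1 epsle n1 d T P mu w [mu1 [mw wmu _]].
apply/negligibleP.
  exact: (measurable_piece_count n
    [set k | n%:R^-1 * ln (k%:R : R) <= ln 2 - xi] mw).
(* When all parameters lie in [tent_params eps], the deterministic bound contradicts the event; the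
   exceptional set is a countable union of null events. *)
apply: (negligibleS (A := \bigcup_k (w k @^-1` ~` tent_params eps))).
  move=> t /= hle; apply: contrapT => nbad.
  have wP k : tent_params eps (w k t).
    by apply: contrapT => nw; apply: nbad; exists k.
  have [m hm] := broken_line_tent_iter (w ^~ t) n (@ler01 R).
  have [fp _] := affine_piecesP (broken_line_affine_partition hm).
  have hk := tent_iter_affine_partition_ge eps1 wP fp.
  move: hle; apply/negP; rewrite /piece_count -ltNge.
  have c0 : 0 < 2 - eps by lra.
  have k0 : 0 < ((2 - eps) ^+ n) by rewrite exprn_gt0.
  have := hk; rewrite -ler_ln ?posrE ?(lt_le_trans k0 hk)// lnXn// => hln.
  have n0 : 0 < n%:R :> R by rewrite ltr0n.
  (* It remains to compare [ln 2 - xi], the logarithm of [2 * expR (- xi)], with [ln (2 - eps)]. *)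
  rewrite mulrC ltr_pdivlMr// (lt_le_trans _ hln)// -[ltRHS]mulr_natr ltr_pM2r//.
  rewrite -(expRK (- xi)) -lnM ?posrE ?expR_gt0// ltr_ln ?posrE ?mulr_gt0 ?expR_gt0//.
  lra.
apply: negligible_bigcup => k; apply/negligibleP.
  rewrite -[X in measurable X]setTI; apply: mw => //; apply: measurableC.
  exact: measurable_tent_params.
transitivity (mu (~` tent_params eps)).
  apply: wmu; apply: measurableC; exact: measurable_tent_params.
by rewrite probability_setC ?mu1 ?subee//; exact: measurable_tent_params.
Qed.
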